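(* Let $\Pi$ be a spherical Pasch space whose boundary at infinity $\partial(\Pi,A)$ at some point $A\in\Pi$ consists of two points. Then $\Pi$ is a circle.
   Context: A betweenness relation on a set $\Pi$ is a ternary relation ''$C$ is between $A$ and $B$'' such that, writing $s[A,B]$ for the set of all points between $A$ and $B$: (a) each point is between itself and any point of $\Pi$; (b) if $A$ is between $B$ and $C$, then $A$ is between $C$ and $B$; (c) if $C\in s[A,B]$, then $s[A,B]=s[A,C]\cup s[C,B]$ and $s[A,C]\cap s[C,B]=s[C,C]=\{C\}$. A closed line segment is a set of the form $s[A,B]$; its interior is $s(A,B)=s[A,B]\setminus\{A,B\}$. A subset $S$ is convex if $s[A,B]\subset S$ for all $A,B\in S$. A closed line segment is connected if, whenever it is expressed as a union of two disjoint non-empty convex subsets, precisely one of them is a closed line segment. A line is a set $l$ with a betweenness relation, consisting of at least two points, such that for every $A\in l$ the complement $l\setminus\{A\}$ is the union of two disjoint non-empty convex sets $c_1,c_2$ with $A\in s[B,C]$ whenever $B\in c_1$, $C\in c_2$. A circle is a set $c$ with a betweenness relation such that: $c$ contains at least three points; each $A\in c$ has an antipodal point $a(A)$ such that $s[A,a(A)]$ contains exactly two points; $s[A,B]$ is connected if $A$ is not antipodal to $B$; for each $A\in c$ the complement $c\setminus\{A,a(A)\}$ is the union of two disjoint non-empty convex sets $l_1,l_2$ that are lines with the betweenness inherited from $c$. A ray emanating from $A$ is a convex set $r$ such that: $A\in r$ but $A$ is not between any two other points of $r$; every three points of $r$ are contained in a closed line segment which is a subset of $r$; $r$ is not equal to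 any closed line segment. It is maximal if it is not a proper subset of another ray emanating from $A$, and connected if the closed line segments contained in it are connected. A space with maximal rays is a set with betweenness such that (1) if $s[A,B]$ and $s[A,C]$ have a common interior point, then one of them is contained in the other; (2) if $A\neq B$ and $s[A,B]$ is connected, then there is a connected $s[C,D]$ with $s[A,B]\subset s(C,D)$. Two maximal rays $r_1,r_2$ emanating from the same point $A$ are antipodal if there are $B\in r_1$, $C\in r_2$ with $A\in s(B,C)$. The boundary at infinity $\partial(\Pi,A)$ is the set of connected maximal rays emanating from $A$. A Pasch space is a space $\Pi$ with maximal rays satisfying the Pasch Condition: for every $A\in\Pi$ and every subset $\{r_1,r_2,r_3\}$ of $\partial(\Pi,A)$ disjoint from the set of its antipodal rays, and all points $B,C\in r_1\setminus\{A\}$ and $D\in r_3\setminus\{A\}$, if $r_2$ intersects $s[B,D]$ then $r_2$ intersects $s[C,D]$. A spherical Pasch space is a Pasch space equipped with a map $a:\Pi\to\Pi$ (the antipodal map) with $a^2=\mathrm{id}$, $a(B)\neq B$ for all $B$, and $a(s[B,C])=s[a(B),a(C)]$ for all $B,C$, such that: for non-antipodal points $A,B$ (i.e. $B\neq a(A)$) $s[A,B]$ is connected; $s[A,B]$ consists of exactly two points if $a(B)=A$; and if $r_1,r_2$ are maximal rays emanating from the same point and $r_1\cup r_2$ contains a pair of antipodal points, then $r_1$ and $r_2$ are antipodal rays. *)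

(* Defs.v *)
(* MathComp classical sets: [set T] is [T -> Prop]; points range over an
   arbitrary type [T]. *)
From mathcomp Require Import all_boot.
From mathcomp Require Import boolp classical_sets functions cardinality.

Set Implicit Arguments.
Unset Strict Implicit.
Unset Printing Implicit Defensive.

Local Open Scope classical_set_scope.
Local Open Scope card_scope.

Section Betweenness.
Variable T : Type.

(* [btw C A B] reads "C is between A and B". *)
Variable btw : T -> T -> T -> Prop.

(* s[A,B] *)
Definition seg (A B : T) : set T := [set C | btw C A B].

(* s(A,B) *)
Definition oseg (A B : T) : set T := seg A B `\` [set A; B].

Record is_betweenness : Prop := IsBetweenness {
  btw_refl : forall A B, btw A A B;
  btw_sym : forall A B C, btw A B C -> btw A C B;
  btw_split : forall A B C, seg A B C ->
    [/\ seg A B = seg A C `|` seg C B,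
        seg A C `&` seg C B = seg C C
      & seg C C = [set C]] }.

Definition is_seg (S : set T) : Prop := exists A B, S = seg A B.

Definition is_convex (S : set T) : Prop :=
  forall A B, S A -> S B -> seg A B `<=` S.

(* Only meant to be applied to closed line segments; this is order-theoretic,
   not topological, connectedness. *)
Definition seg_connected (S : set T) : Prop :=
  forall U V : set T, S = U `|` V -> U `&` V = set0 ->
    U !=set0 -> V !=set0 -> is_convex U -> is_convex V ->
    (is_seg U /\ ~ is_seg V) \/ (~ is_seg U /\ is_seg V).

Record is_line : Prop := IsLine {
  line_btw : is_betweenness;
  line_two_points : `I_2 #<= [set: T];
  line_cut : forall A : T, exists c1 c2 : set T,
    [/\ ~` [set A] = c1 `|` c2, c1 `&` c2 = set0,
        c1 !=set0 /\ c2 !=set0, is_convex c1 /\ is_convex c2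
      & forall B C, c1 B -> c2 C -> seg B C A] }.

Record is_ray (A : T) (r : set T) : Prop := IsRay {
  ray_convex : is_convex r;
  ray_origin : r A;
  ray_end : forall B C, r B -> r C -> B <> A -> C <> A -> ~ btw A B C;
  ray_three : forall P Q R, r P -> r Q -> r R ->
    exists B C, [set P; Q; R] `<=` seg B C /\ seg B C `<=` r;
  ray_not_seg : ~ is_seg r }.

Definition is_maximal_ray (A : T) (r : set T) : Prop :=
  is_ray A r /\ forall r', is_ray A r' -> ~ (r `<` r').

Definition ray_connected (r : set T) : Prop :=
  forall B C, seg B C `<=` r -> seg_connected (seg B C).

Definition antipodal_rays (A : T) (r1 r2 : set T) : Prop :=
  [/\ is_maximal_ray A r1, is_maximal_ray A r2
    & exists B C, [/\ r1 B, r2 C & oseg B C A]].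

Definition boundary (A : T) : set (set T) :=
  [set r | is_maximal_ray A r /\ ray_connected r].

Record has_maximal_rays : Prop := HasMaximalRays {
  maxrays_btw : is_betweenness;
  maxrays_nested : forall A B C, (oseg A B `&` oseg A C) !=set0 ->
    seg A B `<=` seg A C \/ seg A C `<=` seg A B;
  maxrays_extend : forall A B, A <> B -> seg_connected (seg A B) ->
    exists C D, seg_connected (seg C D) /\ seg A B `<=` oseg C D }.

Definition Pasch_condition : Prop :=
  forall (A : T) (r1 r2 r3 : set T),
    [set r1; r2; r3] `<=` boundary A ->
    [set r1; r2; r3] `&`
      [set r' | exists2 r, [set r1; r2; r3] r & antipodal_rays A r r'] = set0 ->
    forall B C D, (r1 `\ A) B -> (r1 `\ A) C -> (r3 `\ A) D ->
      (r2 `&` seg B D) !=set0 -> (r2 `&` seg C D) !=set0.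

Record is_Pasch_space : Prop := IsPaschSpace {
  Pasch_maxrays : has_maximal_rays;
  Pasch_cond : Pasch_condition }.

Record is_spherical_Pasch_space (a : T -> T) : Prop := IsSphericalPaschSpace {
  sph_Pasch : is_Pasch_space;
  sph_involutive : forall B, a (a B) = B;
  sph_fixfree : forall B, a B <> B;
  sph_seg : forall B C, a @` seg B C = seg (a B) (a C);
  sph_connected : forall A B, B <> a A -> seg_connected (seg A B);
  sph_antipodal_seg : forall A B, a B = A -> seg A B #= `I_2;
  sph_antipodal_rays : forall A r1 r2,
    is_maximal_ray A r1 -> is_maximal_ray A r2 ->
    (exists B, (r1 `|` r2) B /\ (r1 `|` r2) (a B)) ->
    antipodal_rays A r1 r2 }.

End Betweenness.

Definition inherited_btw (T : Type) (btw : T -> T -> T -> Prop) (l : set T) :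
    l -> l -> l -> Prop :=
  fun C A B => btw (val C) (val A) (val B).

Record is_circle (T : Type) (btw : T -> T -> T -> Prop) : Prop := IsCircle {
  circle_btw : is_betweenness btw;
  circle_three_points : `I_3 #<= [set: T];
  circle_antipodal : exists a : T -> T,
    [/\ forall A, seg btw A (a A) #= `I_2,
        forall A B, A <> a B -> seg_connected btw (seg btw A B)
      & forall A, exists l1 l2 : set T,
          [/\ ~` [set A; a A] = l1 `|` l2, l1 `&` l2 = set0,
              l1 !=set0 /\ l2 !=set0,
              is_convex btw l1 /\ is_convex btw l2
            & is_line (inherited_btw btw (l := l1)) /\
              is_line (inherited_btw btw (l := l2))]] }.

(* Main.v *)
(* In a segment s[P,Q], "X is between P and Y" is a linear order, and connectedness
   says that this order is complete and dense. Since non-antipodal segments are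
   connected and extendable, the maximal rays from P are all connected and partition
   the points other than P and a(P), and removing its origin from one leaves a line.
   So T is a circle as soon as every P has exactly two maximal rays.

   Every maximal ray has a unique antipodal ray, namely its image under a on the
   points other than the origin. Suppose A has two rays and P is neither A nor
   a(A); let alpha be the ray from P through A, and beta its antipodal ray. For any
   other point X, one of X and a(X) lies on the ray from A through P, say Y. If
   Y is between A and P then Y is on alpha; if P is between A and Y then the ray
   from P through Y is antipodal to alpha, so it is beta. As a exchanges alpha and
   beta, X lies on alpha or beta in all cases, and P has two rays. Applying this
   twice reaches a(A). *)
Require Import Defs.
From mathcomp Require Import all_boot.
From mathcomp Require Import boolp classical_sets functions cardinality.

Set Implicit Arguments.
Unset Strict Implicit.

Local Open Scope classical_set_scope.
Local Open Scope card_scope.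

(** * Segments as linear orders *)

Section SegmentOrder.
Variables (T : Type) (btw : T -> T -> T -> Prop).
Hypothesis hb : is_betweenness btw.
Local Notation s := (seg btw).

Lemma seg_left P Q : s P Q P.
Proof. exact: btw_refl hb _ _. Qed.

Lemma seg_sym P Q X : s P Q X -> s Q P X.
Proof. exact: btw_sym hb _ _ _. Qed.

Lemma segC P Q : s P Q = s Q P.
Proof. by apply/seteqP; split => X; apply: seg_sym. Qed.

Lemma seg_right P Q : s P Q Q.
Proof. by rewrite segC; apply: seg_left. Qed.

Lemma seg_sub P Q X : s P Q X -> s P X `<=` s P Q.
Proof. by move=> /(btw_split hb)[-> _ _]; apply: subsetUl. Qed.

Lemma seg_id P : s P P = [set P].
Proof. by have [_ _] := btw_split hb (seg_left P P). Qed.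

Lemma seg_split P Q X Y : s P Q X -> s P Q Y -> s P X Y \/ s X Q Y.
Proof. by move=> /(btw_split hb)[-> _ _]. Qed.

(** Antisymmetry of the order from [P]: cutting [s P Y] at [X] leaves two pieces that meet only in
    [X], and [Y] lies in both. *)
Lemma seg_anti P X Y : s P Y X -> s P X Y -> X = Y.
Proof.
move=> XY YX; have [_ h1 h2] := btw_split hb XY.
have : (s P X `&` s X Y) Y by split=> //; apply: seg_right.
by rewrite h1 h2 => ->.
Qed.

Lemma seg_inner P Q X Y : s P Y X -> s P Q Y -> s X Q Y.
Proof.
move=> XY YQ; have [YX|//] := seg_split (seg_sub YQ XY) YQ.
by rewrite (seg_anti XY YX); apply: seg_left.
Qed.

Lemma seg_total P Q X Y : s P Q X -> s P Q Y -> s P X Y \/ s P Y X.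
Proof.
move=> XQ YQ; have [|XQY] := seg_split XQ YQ; [by left|right].
by apply/seg_sym; apply: (@seg_inner Q); apply/seg_sym.
Qed.

Lemma seg_convex P Q : is_convex btw (s P Q).
Proof.
have le X Y : s P Q Y -> s P Y X -> s X Y `<=` s P Q.
  move=> YQ XY; apply: subset_trans (seg_sub YQ).
  by rewrite segC [X in _ `<=` X]segC; apply/seg_sub/seg_sym.
move=> X Y XQ YQ; have [YX|XY] := seg_total XQ YQ; last exact: le.
by rewrite segC; apply: le.
Qed.

Lemma seg_between P X Y Z : s P Z X -> s X Z Y -> s P Y X.
Proof.
by move=> /seg_sym XP /seg_sym YX; apply/seg_sym/(seg_inner YX).
Qed.

(** If nothing lay strictly between [X] and [Y], then [s P X] and [s Y Q] would split [s P Q] into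
    two disjoint convex sets that are both closed segments, while connectedness allows only one. *)
Lemma connected_dense P Q X Y :
  seg_connected btw (s P Q) -> s P Q Y -> s P Y X -> X <> Y ->
  oseg btw X Y !=set0.
Proof.
move=> conn YQ XY neq; apply: contrapT => empty.
have XQ : s P Q X by apply: (seg_sub YQ).
have [] : (is_seg btw (s P X) /\ ~ is_seg btw (s Y Q)) \/
          (~ is_seg btw (s P X) /\ is_seg btw (s Y Q)).
- apply: conn; [| |by exists P; apply: seg_left|by exists Q; apply: seg_right
    |exact: seg_convex|exact: seg_convex].
  + apply/seteqP; split=> [Z /(seg_split YQ)[/(seg_split XY)[|XZY]|]|Z []].
    * by left.
    * have [->|ZX] := pselect (Z = X); first by left; apply: seg_right.
      have [->|ZY] := pselect (Z = Y); first by right; apply: seg_left.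
      by case: empty; exists Z; split=> // -[].
    * by right.
    * exact: (seg_sub XQ).
    * exact: (seg_convex YQ (seg_right _ _)).
  + apply/seteqP; split=> // Z [ZX ZQ]; apply: neq.
    have ZY : Z = Y.
      have [_ h1 h2] := btw_split hb YQ.
      have : (s P Y `&` s Y Q) Z by split=> //; apply: (seg_sub XY).
      by rewrite h1 h2.
    by rewrite ZY in ZX; apply: (seg_anti XY ZX).
- by move=> [_ []]; exists Y, Q.
- by move=> [[]]; exists P, X.
Qed.

(** * Rays, ordered from their origin *)

Lemma ray_origin_endpoint P r X Y :
  is_ray btw P r -> r X -> r Y -> s X Y P -> X = P \/ Y = P.
Proof.
move=> hr rX rY XYP.
have [|XP] := pselect (X = P); first by left.
have [|YP] := pselect (Y = P); first by right.
by case: (ray_end hr rX rY XP YP).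
Qed.

(** The segment in [r] that contains [P], [X] and [Y] must have [P] as an endpoint, because [P] is
    between no two other points of [r]. *)
Lemma ray_common_seg P r X Y : is_ray btw P r -> r X -> r Y ->
  exists Q, [/\ r Q, s P Q X & s P Q Y].
Proof.
move=> hr rX rY.
have [U [V [sub UVr]]] := ray_three hr (ray_origin hr) rX rY.
have UVP : s U V P by apply: sub; left; left.
have UVX : s U V X by apply: sub; left; right.
have UVY : s U V Y by apply: sub; right.
have rU : r U by apply/UVr/seg_left.
have rV : r V by apply/UVr/seg_right.
have [UP|VP] := ray_origin_endpoint hr rU rV UVP; subst.
- by exists V.
- by exists U; split=> //; apply: seg_sym.
Qed.

Lemma ray_total P r X Y : is_ray btw P r -> r X -> r Y -> s P X Y \/ s P Y X.
Proof.
by move=> hr rX rY; have [Q [_]] := ray_common_seg hr rX rY; apply: seg_total.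
Qed.

Lemma ray_sub_seg P r X : is_ray btw P r -> r X -> s P X `<=` r.
Proof. by move=> hr rX; apply: (ray_convex hr) => //; apply: ray_origin hr. Qed.

Lemma ray_exists_neq P r : is_ray btw P r -> exists X, r X /\ X <> P.
Proof.
move=> hr; apply: contrapT => no; apply: (ray_not_seg hr).
exists P, P; rewrite seg_id; apply/seteqP; split=> [X rX /=|X ->].
- by apply: contrapT => XP; apply: no; exists X.
- exact: ray_origin hr.
Qed.

Lemma inherited_is_betweenness (l : set T) :
  is_betweenness (inherited_btw btw (l := l)).
Proof.
split=> [X Y|X Y Z|X Y Z XYZ]; first exact: seg_left.
- exact: seg_sym.
- have [h1 h2 h3] := btw_split hb XYZ.
  have E (U V : l) : seg (inherited_btw btw (l := l)) U V
    = (val : l -> T) @^-1` s (val U) (val V) by [].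
  rewrite !E h1 -preimage_setI h2 h3; split=> //.
  by apply/seteqP; split=> [W /val_inj|W ->].
Qed.

End SegmentOrder.

(** * Sets of two and three points *)

Lemma card_I2P (T : Type) (A : set T) :
  A #= `I_2 <-> exists x y, x <> y /\ A = [set x; y].
Proof.
split=> [/eq_cardSP[x Ax /eq_cardSP[y [Ay yx]]]|[x [y [xy ->]]]].
  rewrite II0 card_eq0 => /eqP h; exists x, y; split; first exact: not_eq_sym.
  apply/seteqP; split=> [z Az|z [->|->]] //; apply: contrapT => nz.
  suff : (A `\ x `\ y) z by rewrite h.
  by split; [split=> // zx; apply: nz; left|move=> zy; apply: nz; right].
apply/eq_cardSP; exists x; first by left.
suff -> : [set x; y] `\ x = [set y] by exact: card_set1.
apply/seteqP; split=> [z [[|] //]|z ->]; split; [by right|exact: not_eq_sym].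
Qed.

Lemma card_I3_le (T : Type) (x y z : T) :
  x <> y -> x <> z -> y <> z -> `I_3 #<= [set: T].
Proof.
move=> xy xz yz; apply: (@card_le_trans _ _ _ [set x; y; z]); last exact: subset_card_le.
have /card_eqPle[_ //] : [set x; y; z] #= `I_3.
apply/eq_cardSP; exists z; first by right.
apply/card_I2P; exists x, y; split=> //.
apply/seteqP; split=> [w [[]]//|w [->|->]]; split=> //; [by left; left|by left; right].
Qed.

(** * Nested segments and symmetry of antipodal rays *)

Section MaximalRays.
Variables (T : Type) (btw : T -> T -> T -> Prop).
Hypothesis hm : has_maximal_rays btw.
Local Notation s := (seg btw).
Let hb : is_betweenness btw := maxrays_btw hm.

(** The nesting axiom asks for a common interior point. [X] is one unless it equals [Q] or [Q'], and
    then the claim is one of the hypotheses. *)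
Lemma seg_nested P Q Q' X : X <> P -> s P Q X -> s P Q' X ->
  s P Q Q' \/ s P Q' Q.
Proof.
move=> XP XQ XQ'.
have [E|nQ] := pselect (X = Q); first by subst; right.
have [E|nQ'] := pselect (X = Q'); first by subst; left.
have [sub|sub] : s P Q `<=` s P Q' \/ s P Q' `<=` s P Q.
- by apply: (maxrays_nested hm); exists X; split; split=> // -[].
- by right; apply: sub; apply: (seg_right hb).
- by left; apply: sub; apply: (seg_right hb).
Qed.

Lemma antipodal_rays_sym P r1 r2 :
  antipodal_rays btw P r1 r2 -> antipodal_rays btw P r2 r1.
Proof.
move=> [h1 h2 [B [C [r1B r2C [BCP nP]]]]]; split=> //; exists C, B; split=> //.
by split; [apply: (seg_sym hb)|rewrite setUC].
Qed.

End MaximalRays.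

(** * Antipodal points on segments and rays *)

Section SphericalPasch.
Variables (T : Type) (btw : T -> T -> T -> Prop) (a : T -> T).
Hypothesis hT : is_spherical_Pasch_space btw a.
Local Notation s := (seg btw).
Let hm : has_maximal_rays btw := Pasch_maxrays (sph_Pasch hT).
Let hb : is_betweenness btw := maxrays_btw hm.
Let aK : forall X, a (a X) = X := sph_involutive hT.

Lemma oseg_antipodal X : oseg btw X (a X) = set0.
Proof.
have /card_I2P[y [z [_ E]]] : s X (a X) #= `I_2.
  exact: (sph_antipodal_seg hT).
have XaX : a X <> X := sph_fixfree hT (B := X).
have := seg_left hb X (a X); have := seg_right hb X (a X).
rewrite -subset0 /oseg E => -[] eaX [] eX W [[] -> []]; move: XaX; rewrite eaX eX //;
  by [left|right].
Qed.

(** Density would put a point strictly between [X] and [a X], but [s X (a X)] has no interior. *)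
Lemma connected_no_antipodes P Q X : seg_connected btw (s P Q) ->
  s P Q X -> s P Q (a X) -> False.
Proof.
move=> conn hX haX.
have [h|h] := seg_total hb hX haX.
- have [] : oseg btw (a X) X !=set0.
    exact: (connected_dense hb conn hX h (@sph_fixfree _ _ _ hT X)).
  by rewrite -{2}(aK X) oseg_antipodal.
- have [] : oseg btw X (a X) !=set0.
    by apply: (connected_dense hb conn haX h) => /esym /(@sph_fixfree _ _ _ hT).
  by rewrite oseg_antipodal.
Qed.

Lemma seg_no_antipodes P Q X : Q <> a P -> s P Q X -> s P Q (a X) -> False.
Proof. by move=> /(sph_connected hT)/connected_no_antipodes; apply. Qed.

(** [s P X] lies in the interior of a connected [s C D]. Take for [Q] the endpoint beyond [X] as
    seen from [P]; it is not [a P], since [s C D] already contains [P]. *)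
Lemma seg_extend P X : X <> P -> X <> a P ->
  exists Q, [/\ Q <> a P, s P Q X & Q <> X].
Proof.
move=> XP XaP.
have [C [D [conn sub]]] := maxrays_extend hm (not_eq_sym XP)
  (sph_connected hT XaP).
have [CDP nP] := sub _ (seg_left hb P X).
have [CDX nX] := sub _ (seg_right hb P X).
have [h|h] := seg_total hb CDX CDP.
- exists D; split.
  + move=> E; apply: (connected_no_antipodes conn CDP).
    by rewrite -E; apply: (seg_right hb).
  + exact: (seg_inner hb h).
  + by move=> E; apply: nX; right.
- exists C; split.
  + move=> E; apply: (connected_no_antipodes conn CDP).
    by rewrite -E; apply: (seg_left hb).
  + exact: (seg_sym hb).
  + by move=> E; apply: nX; left.
Qed.

(** Any [X] in [r] would share with [a P] a segment [s P Q], which forces [Q = a P]. Hence [r] would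
    be the segment [s P (a P)]. *)
Lemma ray_no_antipode P r : is_ray btw P r -> ~ r (a P).
Proof.
move=> hr raP; apply: (ray_not_seg hr); exists P, (a P).
apply/seteqP; split; last exact: (ray_sub_seg hr).
move=> X rX; have [Q [_ QaP QX]] := ray_common_seg hb hr raP rX.
have [<- //|nQ] := pselect (Q = a P).
by case: (seg_no_antipodes nQ (seg_left hb P Q) QaP).
Qed.

Lemma ray_no_antipodes P r X : is_ray btw P r -> r X -> ~ r (a X).
Proof.
move=> hr rX raX; have [Q [rQ QX QaX]] := ray_common_seg hb hr rX raX.
by apply: (seg_no_antipodes _ QX QaX) => E; apply: (ray_no_antipode hr); rewrite -E.
Qed.

(** A union of segments from [P] that are nested when [X <> P]. The condition [Q <> a P] makes each
    of them connected, hence free of antipodal pairs. *)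
Definition ray_through P X : set T :=
  [set Y | exists Q, [/\ Q <> a P, s P Q X & s P Q Y]].

Lemma sub_ray_through P X r : is_ray btw P r -> r X -> r `<=` ray_through P X.
Proof.
move=> hr rX Y rY; have [Q [rQ QX QY]] := ray_common_seg hb hr rX rY.
by exists Q; split=> // E; apply: (ray_no_antipode hr); rewrite -E.
Qed.

(** * The maximal ray through a given point *)

Section RayThrough.
Variables P X : T.
Hypotheses (XP : X <> P) (XaP : X <> a P).

Lemma ray_through_mem : ray_through P X X.
Proof. by exists X; split=> //; apply: (seg_right hb). Qed.

Let common Y Z : ray_through P X Y -> ray_through P X Z ->
  exists Q, [/\ Q <> a P, s P Q X, s P Q Y & s P Q Z].
Proof.
move=> [Q [nQ QX QY]] [R [nR RX RZ]].
have [h|h] := seg_nested hm XP QX RX.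
- by exists Q; split=> //; apply: (seg_sub hb h).
- by exists R; split=> //; apply: (seg_sub hb h).
Qed.

(** By [common], finitely many points can be compared inside one segment from [P]. The union is no
    segment because [seg_extend] goes past any last point. *)
Lemma ray_through_is_ray : is_ray btw P (ray_through P X).
Proof.
have endp Y Z : ray_through P X Y -> ray_through P X Z -> Y <> P -> Z <> P ->
    ~ btw P Y Z.
  move=> RY RZ YP ZP PYZ; have [Q [_ _ QY QZ]] := common RY RZ.
  have [h|h] := seg_total hb QY QZ; [apply: ZP|apply: YP].
  - by apply: (@seg_anti _ _ hb Y) => //; apply: (seg_sym hb).
  - by apply: (@seg_anti _ _ hb Z); apply: (seg_sym hb).
split=> //.
- move=> Y Z RY RZ W YZW; have [Q [nQ QX QY QZ]] := common RY RZ.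
  by exists Q; split=> //; apply: (seg_convex hb QY QZ).
- by exists X; split=> //; [apply: (seg_right hb)|apply: (seg_left hb)].
- move=> Y Z W RY RZ RW.
  have [Q [nQ QX QY QZ]] := common RY RZ.
  have RQ : ray_through P X Q by exists Q; split=> //; apply: (seg_right hb).
  have [R [nR RX RQ' RW']] := common RQ RW.
  exists P, R; split=> [V [[->|->]|->] //|V PRV].
  + exact: (seg_sub hb RQ').
  + exact: (seg_sub hb RQ').
  + by exists R.
(* By [endp], a segment equal to the ray would have [P] as an endpoint. *)
- suff noseg V : ray_through P X <> s P V.
    move=> [U [V E]].
    have RU : ray_through P X U by rewrite E; apply: (seg_left hb).
    have RV : ray_through P X V by rewrite E; apply: (seg_right hb).
    have UVP : s U V P.
      by rewrite -E; exists X; split=> //; [apply: (seg_right hb)|apply: (seg_left hb)].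
    have [UP|UP] := pselect (U = P); first by apply: (@noseg V); rewrite E UP.
    have [VP|VP] := pselect (V = P).
      by apply: (@noseg U); rewrite E VP (segC hb).
    exact: (endp U V).
  move=> E.
  have VX : s P V X by rewrite -E; exact: ray_through_mem.
  have VP : V <> P.
    by move=> VP; apply: XP; move: VX; rewrite VP (seg_id hb).
  have VaP : V <> a P.
    have : ray_through P X V by rewrite E; apply: (seg_right hb).
    move=> [Q [nQ _ QV]] VaP; rewrite VaP in QV.
    exact: (seg_no_antipodes nQ (seg_left hb P Q) QV).
  have [Q [nQ QV QnV]] := seg_extend VP VaP.
  apply: QnV; apply: (@seg_anti _ _ hb P) => //.
  rewrite -E; exists Q; split=> //; last exact: (seg_right hb).
  exact: (seg_sub hb QV).
Qed.

Lemma ray_through_maximal : is_maximal_ray btw P (ray_through P X).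
Proof.
split=> [|r' hr' [sub]]; first exact: ray_through_is_ray.
by apply; apply: sub_ray_through => //; apply/sub/ray_through_mem.
Qed.

End RayThrough.

(** * Uniqueness of maximal rays and of antipodal rays *)

Lemma maximal_ray_eq P r r' X : is_maximal_ray btw P r ->
  is_maximal_ray btw P r' -> r X -> r' X -> X <> P -> r = r'.
Proof.
move=> hr hr' rX r'X XP.
have XaP : X <> a P by move=> E; apply: (ray_no_antipode hr.1); rewrite -E.
have key q : is_maximal_ray btw P q -> q X -> q = ray_through P X.
  move=> [hq qmax] qX; have sub := sub_ray_through hq qX.
  apply/seteqP; split=> //; apply: contrapT => nsub.
  by apply: (qmax _ (ray_through_is_ray XP XaP)); split.
by rewrite (key r) // (key r').
Qed.

(** A ray contains no antipodal pair, so all segments in it are connected. *)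
Lemma boundaryE P : boundary btw P = is_maximal_ray btw P.
Proof.
apply/seteqP; split=> [r []//|r hr]; split=> // X Y sub.
apply: (sph_connected hT) => E; apply: (ray_no_antipodes hr.1 (X := X)).
- by apply: sub; apply: (seg_left hb).
- by rewrite -E; apply: sub; apply: (seg_right hb).
Qed.

(** Of the two witnesses on [r], the one nearer to [P] serves for both rays; call it [C]. Then
    [s C B1] and [s C B2] share [P], so they are nested, and the endpoint of the shorter one lies on
    both [r1] and [r2]. *)
Lemma antipodal_rays_unique P r r1 r2 :
  antipodal_rays btw P r r1 -> antipodal_rays btw P r r2 -> r1 = r2.
Proof.
move=> [hr h1 [C1 [B1 [rC1 r1B1 [P1 n1]]]]].
move=> [_ h2 [C2 [B2 [rC2 r2B2 [P2 n2]]]]].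
have [C [nC CP1 CP2]] : exists C, [/\ P <> C, s C B1 P & s C B2 P].
  have [h|h] := ray_total hb hr.1 rC1 rC2.
  - exists C2; split=> //; first by move=> E; apply: n2; left.
    by apply: (@seg_inner _ _ hb C1) => //; apply: (seg_sym hb).
  - exists C1; split=> //; first by move=> E; apply: n1; left.
    by apply: (@seg_inner _ _ hb C2) => //; apply: (seg_sym hb).
have [h|h] := seg_nested hm nC CP1 CP2.
- apply: (maximal_ray_eq h1 h2 (X := B2)) => //.
  + by apply: (ray_sub_seg h1.1 r1B1); apply: (seg_inner hb CP2).
  + by move=> E; apply: n2; right.
- apply: (maximal_ray_eq h1 h2 (X := B1)) => //.
  + by apply: (ray_sub_seg h2.1 r2B2); apply: (seg_inner hb CP1).
  + by move=> E; apply: n1; right.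
Qed.

Lemma ray_through_antipodal P X : X <> P -> X <> a P ->
  antipodal_rays btw P (ray_through P X) (ray_through P (a X)).
Proof.
move=> XP XaP.
have aXP : a X <> P by move=> E; apply: XaP; rewrite -E aK.
have aXaP : a X <> a P by move=> E; apply: XP; rewrite -(aK X) E aK.
apply: (sph_antipodal_rays hT); [exact: ray_through_maximal..|].
by exists X; split; [left|right]; apply: ray_through_mem.
Qed.

(** [r1] is the ray through [X], to which the ray through [a X] is antipodal; uniqueness identifies
    that ray with [r2]. *)
Lemma antipodal_ray_antipode P r1 r2 X : antipodal_rays btw P r1 r2 ->
  r1 X -> X <> P -> r2 (a X).
Proof.
move=> h r1X XP; have [h1 _ _] := h.
have XaP : X <> a P by move=> E; apply: (ray_no_antipode h1.1); rewrite -E.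
have h' := ray_through_antipodal XP XaP.
have E : r1 = ray_through P X.
  apply: (maximal_ray_eq h1 _ r1X) => //; first exact: ray_through_maximal.
  exact: ray_through_mem.
rewrite -E in h'; rewrite (antipodal_rays_unique h h').
by apply: ray_through_mem => E'; apply: XP; rewrite -(aK X) E' aK.
Qed.

(** * Passing from two rays at one point to two rays at every point *)

Definition two_rays P := exists r1 r2, [/\ is_maximal_ray btw P r1,
  is_maximal_ray btw P r2, r1 <> r2 &
  forall X, X <> P -> X <> a P -> r1 X \/ r2 X].

Lemma two_rays_step A P : two_rays A -> P <> A -> P <> a A -> two_rays P.
Proof.
move=> [r1 [r2 [hr1 hr2 _ cover]]] PA PaA.
have AP := not_eq_sym PA.
have AaP : A <> a P by move=> E; apply: PaA; rewrite E aK.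
have anti := ray_through_antipodal AP AaP.
have [alpha_max beta_max _] := anti.
have aAaP : a A <> a P by move=> E; apply: AP; rewrite -(aK A) E aK.
have alphaA := ray_through_mem AaP.
have betaA := ray_through_mem aAaP.
set alpha := ray_through P A in anti alpha_max alphaA *.
set beta := ray_through P (a A) in anti beta_max betaA *.
have same_ray r X : is_maximal_ray btw A r -> r P -> r X -> X <> P ->
    alpha X \/ beta X.
  move=> hr rP rX XP; have [h|h] := ray_total hb hr.1 rP rX.
    by left; apply: (ray_sub_seg alpha_max.1 alphaA); apply: (seg_sym hb).
  right.
  have XaP : X <> a P.
    by move=> E; apply: (ray_no_antipodes hr.1 rP); rewrite -E.
  rewrite (antipodal_rays_unique anti (r2 := ray_through P X)).
    exact: ray_through_mem.
  split=> //; first exact: ray_through_maximal.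
  exists A, X; split=> //; first exact: ray_through_mem.
  by split=> // -[//|E]; apply: XP.
exists alpha, beta; split=> // [E|X XP XaP].
  by rewrite -E in betaA; apply: (ray_no_antipodes alpha_max.1 alphaA).
have [->|XA] := pselect (X = A); first by left.
have [->|XaA] := pselect (X = a A); first by right.
have aXP : a X <> P by move=> E; apply: XaP; rewrite -E aK.
have aXA : a X <> A by move=> E; apply: XaA; rewrite -E aK.
have aXaA : a X <> a A by move=> E; apply: XA; rewrite -(aK X) E aK.
have flip : alpha (a X) \/ beta (a X) -> alpha X \/ beta X.
  move=> [h|h]; [right|left]; rewrite -(aK X).
  - exact: (antipodal_ray_antipode anti).
  - exact: (antipodal_ray_antipode (antipodal_rays_sym hm anti)).
(* [X] and [a X] lie on different rays from [A], so one of them shares a ray with [P]; if it is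
   [a X], [flip] carries the conclusion back to [X]. *)
have no1 := @ray_no_antipodes A r1 X hr1.1.
have no2 := @ray_no_antipodes A r2 X hr2.1.
have [rP|rP] := cover P PA PaA; have [rX|rX] := cover X XA XaA;
  have [raX|raX] := cover (a X) aXA aXaA;
  first [by case: no1|by case: no2|exact: (same_ray r1)|exact: (same_ray r2)
    |by apply: flip; apply: (same_ray r1)|by apply: flip; apply: (same_ray r2)].
Qed.

Lemma two_rays_everywhere A P : two_rays A -> two_rays P.
Proof.
move=> h; have [->//|PA] := pselect (P = A).
have [->|PaA] := pselect (P = a A); last exact: (two_rays_step h).
have [r1 [_ [hr1 _ _ _]]] := h.
(* [B], being neither [A] nor [a A], is an intermediate stop on the way to [a A]. *)
have [B [r1B BA]] := ray_exists_neq hb hr1.1.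
have BaA : B <> a A by move=> E; apply: (ray_no_antipode hr1.1); rewrite -E.
apply: (two_rays_step (two_rays_step h BA BaA)); first exact: not_eq_sym.
by move=> E; apply: BA; rewrite -(aK A) E aK.
Qed.

(** * Rays without their origin are lines *)

Lemma punctured_ray_convex P r : is_ray btw P r -> is_convex btw (r `\ P).
Proof.
move=> hr X Y [rX XP] [rY YP] Z XYZ; split; first exact: (ray_convex hr rX rY).
by move=> E; apply: (ray_end hr rX rY XP YP); rewrite -E.
Qed.

(** A point [X] cuts the rest into the points nearer to [P] and those farther away. The first part
    is non-empty by density of [s P X], the second by [seg_extend]. *)
Lemma punctured_ray_is_line P r : is_maximal_ray btw P r ->
  is_line (inherited_btw btw (l := r `\ P)).
Proof.
move=> hr; have hray := hr.1.
have [X0 [rX0 X0P]] := ray_exists_neq hb hray.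
pose l := r `\ P.
have lP (X : l) : r (val X) /\ val X <> P by exact: (set_valP X).
have mk X : r X -> X <> P -> exists Y : l, val Y = X.
  by move=> rX XP; exists (SigSub (mem_set (conj rX XP : l X))).
have below (X : l) : exists Y : l, s P (val X) (val Y) /\ Y <> X.
  have [rX XP] := lP X.
  have [|Y [XY nY]] := connected_dense hb (sph_connected hT (A := P) (B := val X) _)
    (seg_right hb P (val X)) (seg_left hb P (val X)) (not_eq_sym XP).
    by move=> E; apply: (ray_no_antipode hray); rewrite -E.
  have [|E|Y' E] := mk Y; first exact: (ray_sub_seg hray rX).
    by apply: nY; left.
  by exists Y'; rewrite E; split=> // E'; apply: nY; right; rewrite -E E'.
have above (X : l) : exists Y : l, s P (val Y) (val X) /\ Y <> X.
  have [rX XP] := lP X.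
  have XaP : val X <> a P by move=> E; apply: (ray_no_antipode hray); rewrite -E.
  have [Q [nQ QX QnX]] := seg_extend XP XaP.
  have E : r = ray_through P (val X).
    apply: (maximal_ray_eq hr _ rX) => //; first exact: ray_through_maximal.
    exact: ray_through_mem.
  have [||Y EY] := mk Q.
  - by rewrite E; exists Q; split=> //; apply: (seg_right hb).
  - by move=> QP; apply: XP; move: QX; rewrite QP (seg_id hb).
  - by exists Y; rewrite EY; split=> // E'; apply: QnX; rewrite -EY E'.
split; first exact: inherited_is_betweenness.
  have [X _] := mk X0 rX0 X0P; have [Y [_ YX]] := below X.
  apply: (@card_le_trans _ _ _ [set Y; X]); last exact: subset_card_le.
  have /card_eqPle[_ //] : [set Y; X] #= `I_2.
  by apply/card_I2P; exists Y, X.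
move=> X.
exists [set Y : l | s P (val X) (val Y) /\ Y <> X],
  [set Y : l | s P (val Y) (val X) /\ Y <> X]; split.
- apply/seteqP; split=> [Y YX|Y [[]|[]] //].
  by have [h|h] := ray_total hb hray (lP X).1 (lP Y).1; [left|right].
- apply/seteqP; split=> // Y [[h1 YX] [h2 _]]; apply: YX.
  exact/val_inj/(seg_anti hb h1 h2).
- by split; [have [Y] := below X|have [Y] := above X]; exists Y.
- split=> Y Z [hY YX] [hZ ZX] W YZW; split.
  + exact: (seg_convex hb hY hZ).
  (* If [X] were between [Y] and [Z], the farther of these from [P] would equal [X]. *)
  + move=> WX; rewrite {}WX in YZW.
    have [h|h] := seg_total hb hY hZ; [apply: YX|apply: ZX]; apply: val_inj.
    * apply: (seg_anti hb hY); apply: (seg_convex hb _ _ YZW).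
        exact: (seg_right hb).
      exact: h.
    * apply: (seg_anti hb hZ); apply: (seg_convex hb _ _ YZW).
        exact: h.
      exact: (seg_right hb).
  (* The nearer of [Y] and [Z] lies between [P] and [W], and [X] lies between [P] and that point. *)
  + have [h|h] := ray_total hb hray (lP Y).1 (lP Z).1.
    * exact: (seg_sub hb (seg_between hb h (seg_sym hb YZW)) hZ).
    * exact: (seg_sub hb (seg_between hb h YZW) hY).
  + move=> WX; rewrite {}WX in YZW.
    have [h|h] := ray_total hb hray (lP Y).1 (lP Z).1;
      [apply: ZX|apply: YX]; apply: val_inj.
    * exact: (seg_anti hb (seg_between hb h (seg_sym hb YZW)) hZ).
    * exact: (seg_anti hb (seg_between hb h YZW) hY).
- move=> Y Z [hY YX] [hZ ZX]; exact: (seg_inner hb hY hZ).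
Qed.

End SphericalPasch.

(** * Assembling the circle *)

Theorem proposition13p8 (T : Type) (btw : T -> T -> T -> Prop) (a : T -> T)
    (A : T) (hT : is_spherical_Pasch_space btw a)
    (hA : boundary btw A #= `I_2) : is_circle btw.
Proof.
have hm := Pasch_maxrays (sph_Pasch hT); have hb := maxrays_btw hm.
have rays P : two_rays btw a P.
  apply: (two_rays_everywhere hT (A := A)).
  have /card_I2P[r1 [r2 [r12 E]]] := hA; rewrite (boundaryE hT) in E.
  exists r1, r2; split=> //.
  - by rewrite E; left.
  - by rewrite E; right.
  (* The maximal ray through [X] must be one of the two elements of the boundary. *)
  - move=> X XA XaA; have := ray_through_maximal hT XA XaA.
    by rewrite E => -[<-|<-]; [left|right]; apply: ray_through_mem.
have fixfree := sph_fixfree hT.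
split=> //.
- have [r [_ [hr _ _ _]]] := rays A.
  have [X [rX XA]] := ray_exists_neq hb hr.1.
  apply: (@card_I3_le _ A (a A) X); [exact/not_eq_sym/fixfree|exact: not_eq_sym|].
  by move=> E; apply: (ray_no_antipode hT hr.1); rewrite E.
- exists a; split.
  + by move=> P; apply: (sph_antipodal_seg hT); exact: (sph_involutive hT).
  + move=> P Q PaQ; apply: (sph_connected hT) => E; apply: PaQ.
    by rewrite E (sph_involutive hT).
  + move=> P; have [r1 [r2 [h1 h2 r12 cover]]] := rays P.
    exists (r1 `\ P), (r2 `\ P); split.
    * apply/seteqP; split=> [X nX|X].
        have XP : X <> P by move=> E; apply: nX; left.
        have XaP : X <> a P by move=> E; apply: nX; right.
        by have [h|h] := cover X XP XaP; [left|right].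
      by move=> [] [rX XP] [//|E]; rewrite E in rX;
        [apply: (ray_no_antipode hT h1.1)|apply: (ray_no_antipode hT h2.1)].
    * apply/seteqP; split=> // X [[r1X XP] [r2X _]]; apply: r12.
      exact: (maximal_ray_eq hT h1 h2 r1X r2X XP).
    * by split; [have [X [? ?]] := ray_exists_neq hb h1.1
        |have [X [? ?]] := ray_exists_neq hb h2.1]; exists X.
    * by split; [apply: punctured_ray_convex h1.1|apply: punctured_ray_convex h2.1].
    * by split; apply: (punctured_ray_is_line hT).
Qed.
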